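(* Let $\mathscr G\alpha(\zeta,q)=\sum_{n=0}^\infty\zeta^n\sum_{s=0}^\infty q^s\alpha(n,s)$. This double series converges absolutely for all $\zeta,q\in\mathbb C$ with $|\zeta|<1$ and $|q|\le1$, and for such $\zeta,q$, \[ \mathscr G\alpha(\zeta,q)=\frac{2\zeta(1-q)\,[N-\zeta(N-2+2q)]^{-1}}{N(1-\zeta)^2\,\mathrm{tr}\big((N-\zeta(N-2+2Q))^{-1}\big)}. \]
   Context: $E$ is a finite set with $N=\#E>8$ elements; $Q$ is an irreducible stochastic matrix on $E$ with $Q(x,y)=Q(y,x)$ for all $x,y$ and $\mathrm{tr}(Q)=0$; $I$ is the identity matrix, and $(N-\zeta(N-2+2Q))^{-1}$ is the matrix inverse of $NI-\zeta((N-2)I+2Q)$. The function $\alpha:\mathbb Z_+\times\mathbb Z_+\to\mathbb R$ is defined by $\alpha(0,s)=0$ for all $s$ and, for $n\in\mathbb Z_+$, $\alpha(n+1,0)=\frac2{N^2}+\alpha(n,0)+\frac2{N^2}\sum_{s\ge1}\alpha(n,s)\mathrm{tr}(Q^s)$, $\alpha(n+1,1)=-\frac2{N^2}+\frac{N-2}N\alpha(n,1)-\frac2{N^2}\sum_{s\ge1}\alpha(n,s)\mathrm{tr}(Q^s)$, $\alpha(n+1,s)=\frac{N-2}N\alpha(n,s)+\frac2N\alpha(n,s-1)$ for $s\ge2$ (so $\alpha(n,s)=0$ for $s\ge n+1$). *)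

(* Defs.v *)
From Stdlib Require Import Reals.
Open Scope R_scope.

Record Cplx := mkC { Re : R ; Im : R }.

Definition RtoC (x : R) : Cplx := mkC x 0.
Definition Czero : Cplx := RtoC 0.
Definition Cone : Cplx := RtoC 1.
Definition Cadd (z w : Cplx) : Cplx := mkC (Re z + Re w) (Im z + Im w).
Definition Copp (z : Cplx) : Cplx := mkC (- Re z) (- Im z).
Definition Csub (z w : Cplx) : Cplx := Cadd z (Copp w).
Definition Cmul (z w : Cplx) : Cplx :=
  mkC (Re z * Re w - Im z * Im w) (Re z * Im w + Im z * Re w).
Definition Cnorm (z : Cplx) : R := sqrt (Re z * Re z + Im z * Im z).
Definition Cinv (z : Cplx) : Cplx :=
  let d := Re z * Re z + Im z * Im z in mkC (Re z / d) (- Im z / d).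
Definition Cdiv (z w : Cplx) : Cplx := Cmul z (Cinv w).
Fixpoint Cpow (z : Cplx) (n : nat) : Cplx :=
  match n with O => Cone | S k => Cmul z (Cpow z k) end.

Definition Ccv (u : nat -> Cplx) (l : Cplx) : Prop :=
  forall eps : R, eps > 0 ->
    exists K0 : nat, forall K : nat, (K >= K0)%nat -> Cnorm (Csub (u K) l) < eps.

Fixpoint rsum (n : nat) (f : nat -> R) : R :=
  match n with O => 0 | S k => rsum k f + f k end.
Fixpoint csum (n : nat) (f : nat -> Cplx) : Cplx :=
  match n with O => Czero | S k => Cadd (csum k f) (f k) end.

Definition delta (i j : nat) : R := if Nat.eq_dec i j then 1 else 0.

Definition Rmat_mul (N : nat) (A B : nat -> nat -> R) : nat -> nat -> R :=
  fun i j => rsum N (fun k => A i k * B k j).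
Fixpoint Rmat_pow (N : nat) (A : nat -> nat -> R) (k : nat) : nat -> nat -> R :=
  match k with O => delta | S m => Rmat_mul N A (Rmat_pow N A m) end.
Definition Rtrace (N : nat) (A : nat -> nat -> R) : R := rsum N (fun i => A i i).

Definition Cmat_mul (N : nat) (A B : nat -> nat -> Cplx) : nat -> nat -> Cplx :=
  fun i j => csum N (fun k => Cmul (A i k) (B k j)).
Definition Ctrace (N : nat) (A : nat -> nat -> Cplx) : Cplx := csum N (fun i => A i i).

Definition Cmat_inverse (N : nat) (A X : nat -> nat -> Cplx) : Prop :=
  forall i j, (i < N)%nat -> (j < N)%nat ->
    Cmat_mul N A X i j = RtoC (delta i j) /\ Cmat_mul N X A i j = RtoC (delta i j).

Definition stochastic (N : nat) (Q : nat -> nat -> R) : Prop :=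
  (forall x y, (x < N)%nat -> (y < N)%nat -> 0 <= Q x y) /\
  (forall x, (x < N)%nat -> rsum N (fun y => Q x y) = 1).

Definition irreducible (N : nat) (Q : nat -> nat -> R) : Prop :=
  forall x y, (x < N)%nat -> (y < N)%nat -> exists k : nat, Rmat_pow N Q k x y > 0.

Definition symmetric (N : nat) (Q : nat -> nat -> R) : Prop :=
  forall x y, (x < N)%nat -> (y < N)%nat -> Q x y = Q y x.

(* alpha_row N Q n s = alpha(n,s).  The series sum_{s>=1} alpha(n,s) tr(Q^s)
   is written as the finite sum over 1 <= s <= n, which is exact because
   alpha(n,s) = 0 for s >= n+1 (a consequence of the recursion). *)
Fixpoint alpha_row (N : nat) (Q : nat -> nat -> R) (n : nat) : nat -> R :=
  match n with
  | O => fun _ => 0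
  | S m =>
      let a := alpha_row N Q m in
      let NR := INR N in
      let Ssum := rsum m (fun i => a (S i) * Rtrace N (Rmat_pow N Q (S i))) in
      fun s =>
        match s with
        | O => 2 / (NR * NR) + a O + 2 / (NR * NR) * Ssum
        | 1%nat => - (2 / (NR * NR)) + (NR - 2) / NR * a 1%nat - 2 / (NR * NR) * Ssum
        | S (S _ as p) => (NR - 2) / NR * a s + 2 / NR * a p
        end
  end.

Definition alpha (N : nat) (Q : nat -> nat -> R) (n s : nat) : R := alpha_row N Q n s.

Definition Gterm (N : nat) (Q : nat -> nat -> R) (zeta q : Cplx) (n s : nat) : Cplx :=
  Cmul (Cmul (Cpow zeta n) (Cpow q s)) (RtoC (alpha N Q n s)).

Definition Gpartial (N : nat) (Q : nat -> nat -> R) (zeta q : Cplx) (K : nat) : Cplx :=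
  csum K (fun n => csum K (fun s => Gterm N Q zeta q n s)).
Definition Gabs_partial (N : nat) (Q : nat -> nat -> R) (zeta q : Cplx) (K : nat) : R :=
  rsum K (fun n => rsum K (fun s => Cnorm (Gterm N Q zeta q n s))).

Definition Mzeta (N : nat) (Q : nat -> nat -> R) (zeta : Cplx) : nat -> nat -> Cplx :=
  fun i j => Csub (RtoC (INR N * delta i j))
                  (Cmul zeta (RtoC ((INR N - 2) * delta i j + 2 * Q i j))).

(* Main.v *)
(** Write [P = ((N-2) + 2Q)/N], [c_n = (2/N^2)(1 + sum_(s>=1) alpha(n,s) tr Q^s)]
    and [R_n(x) = sum_(s>=1) alpha(n,s) x^s].  The recursion says
    [alpha(n+1,0) = alpha(n,0) + c_n] and
    [R_(n+1)(x) = - c_n x + ((N-2+2x)/N) R_n(x)].  Multiplying by [zeta^n] and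
    summing gives linear equations for the generating functions, both at [x = q]
    and, entrywise, at [x = Q]; the trace of the latter determines [sum c_n zeta^n].
    That equation also shows that the trace of the resolvent does not vanish.

    Convergence in the whole unit disc needs [c_n] bounded.  The recursion yields
    [N c_(n+1) = 2/N + beta tr W_n - tr (P W_n)] with [beta = 1 - 2/N] and
    [W_n = sum_(k<=n) c_k P^(n-k)].  As [P] and [1 - P] are positive semidefinite,
    [tr P^j] is nonincreasing, hence [0 <= tr (P W_n) <= tr W_n <= 1], and
    [0 <= c_n <= 1/N] by induction. *)

Require Import Defs.
From Stdlib Require Import Reals.
From Stdlib Require Import Lia Lra.
From Coquelicot Require Import Rcomplements Rbar Hierarchy Lim_seq Series.
Open Scope R_scope.

(** * Finite sums and real matrices *)

Lemma rsum_ext (n : nat) (f g : nat -> R) :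
  (forall i, (i < n)%nat -> f i = g i) -> rsum n f = rsum n g.
Proof.
  induction n as [|n IH]; intros H; simpl; [reflexivity|].
  rewrite IH by (intros; apply H; lia). now rewrite (H n) by lia.
Qed.

Lemma rsum_plus (n : nat) (f g : nat -> R) :
  rsum n (fun i => f i + g i) = rsum n f + rsum n g.
Proof. induction n as [|n IH]; simpl; [ring|rewrite IH; ring]. Qed.

Lemma rsum_scal (n : nat) (a : R) (f : nat -> R) :
  rsum n (fun i => a * f i) = a * rsum n f.
Proof. induction n as [|n IH]; simpl; [ring|rewrite IH; ring]. Qed.

Lemma rsum_zero (n : nat) : rsum n (fun _ => 0) = 0.
Proof. induction n as [|n IH]; simpl; [|rewrite IH]; ring. Qed.

Lemma rsum_exchange (n m : nat) (f : nat -> nat -> R) :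
  rsum n (fun i => rsum m (fun j => f i j)) =
  rsum m (fun j => rsum n (fun i => f i j)).
Proof.
  induction n as [|n IH]; simpl.
  - now rewrite rsum_zero.
  - now rewrite IH, <- rsum_plus.
Qed.

Lemma rsum_le (n : nat) (f g : nat -> R) :
  (forall i, (i < n)%nat -> f i <= g i) -> rsum n f <= rsum n g.
Proof.
  induction n as [|n IH]; intros H; simpl; [lra|].
  apply Rplus_le_compat; [apply IH; intros; apply H|apply H]; lia.
Qed.

Lemma rsum_nonneg (n : nat) (f : nat -> R) :
  (forall i, (i < n)%nat -> 0 <= f i) -> 0 <= rsum n f.
Proof. intros H. rewrite <- (rsum_zero n). now apply rsum_le. Qed.

Lemma rsum_const (n : nat) (a : R) : rsum n (fun _ => a) = INR n * a.
Proof.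
  induction n as [|n IH]; [simpl; ring|].
  rewrite S_INR; simpl rsum; rewrite IH; ring.
Qed.

Lemma rsum_head (n : nat) (f : nat -> R) :
  rsum (S n) f = f O + rsum n (fun i => f (S i)).
Proof.
  induction n as [|n IH]; [simpl; ring|].
  change (rsum (S (S n)) f) with (rsum (S n) f + f (S n)).
  rewrite IH; simpl; ring.
Qed.

Lemma rsum_widen (m n : nat) (f : nat -> R) :
  (m <= n)%nat -> (forall i, (m <= i)%nat -> f i = 0) -> rsum n f = rsum m f.
Proof.
  intros Hmn Hf. induction Hmn as [|n Hmn IH]; [reflexivity|].
  simpl. rewrite IH, Hf by assumption. ring.
Qed.

Lemma rsum_delta_l (n i : nat) (f : nat -> R) :
  (i < n)%nat -> rsum n (fun k => delta i k * f k) = f i.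
Proof.
  intros Hi. induction n as [|n IH]; [lia|]. simpl.
  unfold delta at 2. destruct (Nat.eq_dec i n) as [->|Hn].
  - rewrite (rsum_ext n _ (fun _ => 0)), rsum_zero; [ring|].
    intros k Hk. unfold delta. destruct (Nat.eq_dec n k); [lia|ring].
  - rewrite IH by lia. ring.
Qed.

Lemma delta_sym (i j : nat) : delta i j = delta j i.
Proof.
  unfold delta. destruct (Nat.eq_dec i j), (Nat.eq_dec j i); congruence.
Qed.

Lemma Rmat_mul_delta_r (N : nat) (A : nat -> nat -> R) (i j : nat) :
  (j < N)%nat -> Rmat_mul N A delta i j = A i j.
Proof.
  intros Hj. unfold Rmat_mul.
  rewrite (rsum_ext N _ (fun k => delta j k * A i k)).
  - now apply (rsum_delta_l N j (A i)).
  - intros k _. rewrite delta_sym. ring.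
Qed.

(** * Powers of stochastic and of symmetric matrices *)

Lemma stochastic_pow_bounds (N : nat) (A : nat -> nat -> R) (n i j : nat) :
  stochastic N A -> (i < N)%nat -> 0 <= Rmat_pow N A n i j <= 1.
Proof.
  intros [Hpos Hrow]. revert i.
  induction n as [|n IH]; intros i Hi; simpl.
  - unfold delta. destruct (Nat.eq_dec i j); lra.
  - unfold Rmat_mul. split.
    + apply rsum_nonneg. intros k Hk.
      apply Rmult_le_pos; [now apply Hpos|now apply IH].
    + rewrite <- (Hrow i Hi). apply rsum_le. intros k Hk.
      specialize (IH k Hk). specialize (Hpos i k Hi Hk). nra.
Qed.

(** In matrix form, [(A B)^T C = B^T (A C)]: a symmetric factor can be moved across an inner product
    of columns. *)
Lemma symmetric_mul_adjoint (N : nat) (A B C : nat -> nat -> R) (i j : nat) :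
  symmetric N A ->
  rsum N (fun k => Rmat_mul N A B k i * C k j) =
  rsum N (fun k => B k i * Rmat_mul N A C k j).
Proof.
  intros Hsym. unfold Rmat_mul.
  rewrite (rsum_ext N _ (fun k => rsum N (fun l => C k j * (A k l * B l i)))).
  2:{ intros k _. rewrite rsum_scal. ring. }
  rewrite rsum_exchange. apply rsum_ext. intros l Hl.
  rewrite <- rsum_scal. apply rsum_ext. intros k Hk.
  rewrite (Hsym k l Hk Hl). ring.
Qed.

(** Moving the factors [A] one at a time from left to right exhibits [A^(a+b)] as a Gram matrix of
    columns. This is what turns traces of powers into sums of quadratic forms. *)
Lemma symmetric_pow_mul (N : nat) (A : nat -> nat -> R) (a b i j : nat) :
  symmetric N A -> (i < N)%nat ->
  rsum N (fun k => Rmat_pow N A a k i * Rmat_pow N A b k j) =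
  Rmat_pow N A (a + b) i j.
Proof.
  intros Hsym Hi. revert b. induction a as [|a IH]; intros b.
  - simpl. rewrite (rsum_ext N _ (fun k => delta i k * Rmat_pow N A b k j)).
    + now apply (rsum_delta_l N i (fun k => Rmat_pow N A b k j)).
    + intros k _. now rewrite delta_sym.
  - simpl Rmat_pow at 1. rewrite symmetric_mul_adjoint by assumption.
    change (Rmat_mul N A (Rmat_pow N A b)) with (Rmat_pow N A (S b)).
    rewrite IH. f_equal. lia.
Qed.

Lemma symmetric_pow (N : nat) (A : nat -> nat -> R) (n : nat) :
  symmetric N A -> symmetric N (Rmat_pow N A n).
Proof.
  intros Hsym i j Hi Hj.
  rewrite <- (Nat.add_0_r n) at 1.
  rewrite <- symmetric_pow_mul by assumption. simpl.
  rewrite (rsum_ext N _ (fun k => delta j k * Rmat_pow N A n k i)).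
  - now apply (rsum_delta_l N j (fun k => Rmat_pow N A n k i)).
  - intros k _. rewrite delta_sym. ring.
Qed.

(** * Quadratic forms and monotonicity of traces *)

Definition quad (N : nat) (A : nat -> nat -> R) (v : nat -> R) : R :=
  rsum N (fun i => v i * rsum N (fun k => A i k * v k)).

(** Row sums are 1 and, by symmetry, so are column sums; hence each of the two pure squares
    contributes [|v|^2]. The sign [e] is taken to be 1 and -1 below. *)
Lemma quad_square_expand (N : nat) (A : nat -> nat -> R) (v : nat -> R) (e : R) :
  stochastic N A -> symmetric N A -> e * e = 1 ->
  rsum N (fun i => rsum N (fun k => A i k * ((v i + e * v k) * (v i + e * v k)))) =
  2 * (rsum N (fun i => v i * v i) + e * quad N A v).
Proof.
  intros [_ Hrow] Hsym He. unfold quad.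
  assert (H1 : rsum N (fun i => rsum N (fun k => A i k * (v i * v i))) =
               rsum N (fun i => v i * v i)).
  { apply rsum_ext. intros i Hi.
    rewrite (rsum_ext N _ (fun k => (v i * v i) * A i k)) by (intros; ring).
    rewrite (rsum_scal N _ (fun k => A i k)), (Hrow i Hi). ring. }
  assert (H2 : rsum N (fun i => rsum N (fun k => A i k * (v k * v k))) =
               rsum N (fun i => v i * v i)).
  { rewrite rsum_exchange, <- H1. apply rsum_ext. intros k Hk.
    apply rsum_ext. intros i Hi. now rewrite (Hsym i k Hi Hk). }
  assert (H3 : rsum N (fun i => rsum N (fun k => A i k * (v i * v k))) =
               rsum N (fun i => v i * rsum N (fun k => A i k * v k))).
  { apply rsum_ext. intros i Hi. rewrite <- rsum_scal.
    apply rsum_ext. intros. ring. }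
  rewrite (rsum_ext N _ (fun i =>
     rsum N (fun k => A i k * (v i * v i)) +
     (rsum N (fun k => A i k * (v k * v k)) +
      2 * e * rsum N (fun k => A i k * (v i * v k))))).
  - rewrite !rsum_plus, rsum_scal, H1, H2, H3. ring.
  - intros i _. rewrite <- rsum_scal, <- !rsum_plus. apply rsum_ext.
    intros k _.
    replace (A i k * (v k * v k)) with (A i k * (e * e * (v k * v k)))
      by (rewrite He; ring).
    ring.
Qed.

Lemma quad_bounds (N : nat) (A : nat -> nat -> R) (v : nat -> R) :
  stochastic N A -> symmetric N A ->
  - rsum N (fun i => v i * v i) <= quad N A v <= rsum N (fun i => v i * v i).
Proof.
  intros Hst Hsym.
  assert (H : forall e, 0 <= rsum N (fun i => rsum N (fun k =>
            A i k * ((v i + e * v k) * (v i + e * v k))))).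
  { intros e. apply rsum_nonneg; intros i Hi. apply rsum_nonneg; intros k Hk.
    apply Rmult_le_pos; [now apply Hst|apply Rle_0_sqr]. }
  pose proof (H 1) as H1. pose proof (H (-1)) as H2.
  rewrite quad_square_expand in H1 by (assumption || ring).
  rewrite quad_square_expand in H2 by (assumption || ring).
  lra.
Qed.

Lemma Rtrace_pow_add (N : nat) (A : nat -> nat -> R) (a b : nat) :
  symmetric N A ->
  Rtrace N (Rmat_pow N A (a + b)) =
  rsum N (fun i => rsum N (fun k => Rmat_pow N A a k i * Rmat_pow N A b k i)).
Proof.
  intros Hsym. apply rsum_ext. intros i Hi. now rewrite symmetric_pow_mul.
Qed.

(* On odd powers this is the identity [A (1-A) = A (1-A) A + (1-A) A (1-A)]. *)
Lemma Rtrace_pow_decr (N : nat) (A : nat -> nat -> R) (n : nat) :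
  stochastic N A -> symmetric N A -> (forall v, 0 <= quad N A v) ->
  Rtrace N (Rmat_pow N A (S n)) <= Rtrace N (Rmat_pow N A n).
Proof.
  intros Hst Hsym Hpsd.
  (* The trace of [A^(2k+1)] is the sum of the forms of [A] at the columns of [A^k], and the trace
     of [A^(2k)] is the sum of their squared norms. *)
  assert (Heven : forall k, Rtrace N (Rmat_pow N A (S (k + k))) <=
                            Rtrace N (Rmat_pow N A (k + k))).
  { intros k. replace (S (k + k)) with (k + S k)%nat by lia.
    rewrite !Rtrace_pow_add by assumption. apply rsum_le. intros i Hi.
    now apply (quad_bounds N A (fun l => Rmat_pow N A k l i)). }
  (* The second difference of the traces is the sum over [i] of the form of [A] at column [i] of
     [A^k - A^(k+1)]. *)
  assert (Hconv : forall k, 0 <= Rtrace N (Rmat_pow N A (k + S k))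
     - 2 * Rtrace N (Rmat_pow N A (S k + S k))
     + Rtrace N (Rmat_pow N A (S k + S (S k)))).
  { intros k.
    (* Expanding this form produces the power [2k+2] in two ways, as an inner product of columns of
       [A^(k+1)] with themselves and of [A^k] with [A^(k+2)]. *)
    assert (E : Rtrace N (Rmat_pow N A (S k + S k)) =
                Rtrace N (Rmat_pow N A (k + S (S k)))) by (f_equal; f_equal; lia).
    replace (Rtrace N (Rmat_pow N A (k + S k))
     - 2 * Rtrace N (Rmat_pow N A (S k + S k))
     + Rtrace N (Rmat_pow N A (S k + S (S k)))) with
     (Rtrace N (Rmat_pow N A (k + S k))
     + (-1) * Rtrace N (Rmat_pow N A (k + S (S k)))
     + ((-1) * Rtrace N (Rmat_pow N A (S k + S k))
     + Rtrace N (Rmat_pow N A (S k + S (S k))))) by (rewrite E; ring).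
    rewrite !Rtrace_pow_add by assumption.
    rewrite <- !rsum_scal, <- !rsum_plus.
    apply rsum_nonneg. intros i Hi.
    rewrite <- !rsum_scal, <- !rsum_plus.
    replace (rsum N _) with
      (quad N A (fun l => Rmat_pow N A k l i + (-1) * Rmat_pow N A (S k) l i)).
    - apply Hpsd.
    - apply rsum_ext. intros l Hl.
      rewrite (rsum_ext N (fun p => A l p * _) (fun p =>
         A l p * Rmat_pow N A k p i + (-1) * (A l p * Rmat_pow N A (S k) p i)))
        by (intros; ring).
      rewrite rsum_plus, rsum_scal.
      change (rsum N (fun p => A l p * Rmat_pow N A k p i))
        with (Rmat_pow N A (S k) l i).
      change (rsum N (fun p => A l p * Rmat_pow N A (S k) p i))
        with (Rmat_pow N A (S (S k)) l i).
      ring. }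
  destruct (Nat.Even_or_Odd n) as [[k ->]|[k ->]].
  - replace (2 * k)%nat with (k + k)%nat by lia. apply Heven.
  (* With [t_m] the trace of [A^m]: [2 t_(2k+2) <= t_(2k+1) + t_(2k+3) <= t_(2k+1) + t_(2k+2)]. *)
  - specialize (Hconv k). pose proof (Heven (S k)) as He.
    replace (S k + S (S k))%nat with (S (S k + S k)) in Hconv by lia.
    replace (S (2 * k + 1)) with (S k + S k)%nat by lia.
    replace (2 * k + 1)%nat with (k + S k)%nat by lia.
    lra.
Qed.

(** * The lazy walk and the coefficients *)

(** The matrix [P] of the overview, for which [N - zeta (N-2+2Q) = N (1 - zeta P)]. *)
Definition lazy (N : nat) (Q : nat -> nat -> R) (i j : nat) : R :=
  (INR N - 2) / INR N * delta i j + 2 / INR N * Q i j.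

Lemma lazy_mul (N : nat) (Q B : nat -> nat -> R) (i j : nat) :
  (i < N)%nat ->
  Rmat_mul N (lazy N Q) B i j =
  (INR N - 2) / INR N * B i j + 2 / INR N * Rmat_mul N Q B i j.
Proof.
  intros Hi. unfold Rmat_mul, lazy.
  rewrite (rsum_ext N _ (fun k => (INR N - 2) / INR N * (delta i k * B k j)
                                 + 2 / INR N * (Q i k * B k j))) by (intros; ring).
  now rewrite rsum_plus, !rsum_scal, (rsum_delta_l N i (fun k => B k j)).
Qed.

Lemma lazy_symmetric (N : nat) (Q : nat -> nat -> R) :
  symmetric N Q -> symmetric N (lazy N Q).
Proof.
  intros H i j Hi Hj. unfold lazy. now rewrite delta_sym, (H i j Hi Hj).
Qed.

Lemma lazy_stochastic (N : nat) (Q : nat -> nat -> R) :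
  (2 <= N)%nat -> stochastic N Q -> stochastic N (lazy N Q).
Proof.
  intros HN [Hpos Hrow].
  assert (H2 : 2 <= INR N) by (apply (le_INR 2); assumption).
  assert (Hi0 : 0 < / INR N) by (apply Rinv_0_lt_compat; lra).
  split.
  - intros i j Hi Hj. specialize (Hpos i j Hi Hj). unfold lazy, Rdiv.
    apply Rplus_le_le_0_compat; apply Rmult_le_pos; trivial.
    + apply Rmult_le_pos; lra.
    + unfold delta. destruct (Nat.eq_dec i j); lra.
    + lra.
  - intros i Hi. unfold lazy.
    rewrite rsum_plus, rsum_scal, (rsum_scal N _ (fun j => Q i j)), (Hrow i Hi).
    rewrite (rsum_ext N _ (fun j => delta i j * 1)) by (intros; ring).
    rewrite (rsum_delta_l N i (fun _ => 1)) by assumption. field. lra.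
Qed.

(** Since the form of [Q] is at least [- |v|^2], that of [P] is at least [(N-4)/N |v|^2]. *)
Lemma lazy_quad_nonneg (N : nat) (Q : nat -> nat -> R) (v : nat -> R) :
  (4 <= N)%nat -> stochastic N Q -> symmetric N Q -> 0 <= quad N (lazy N Q) v.
Proof.
  intros HN Hst Hsym.
  assert (H4 : 4 <= INR N) by (apply (le_INR 4) in HN; simpl in HN; lra).
  assert (E : quad N (lazy N Q) v =
    ((INR N - 2) * rsum N (fun i => v i * v i) + 2 * quad N Q v) / INR N).
  { unfold quad. unfold Rdiv. rewrite <- !rsum_scal, <- rsum_plus, Rmult_comm, <- rsum_scal.
    apply rsum_ext. intros i Hi.
    pose proof (lazy_mul N Q (fun k _ => v k) i O Hi) as L. unfold Rmat_mul in L.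
    rewrite L. field. lra. }
  rewrite E. pose proof (quad_bounds N Q v Hst Hsym).
  assert (0 <= rsum N (fun i => v i * v i))
    by (apply rsum_nonneg; intros; apply Rle_0_sqr).
  apply Rmult_le_pos; [nra|]. left; apply Rinv_0_lt_compat; lra.
Qed.

(** * The recursion and the coefficients [c_n] *)

Definition incr (N : nat) (Q : nat -> nat -> R) (n : nat) : R :=
  2 / (INR N * INR N) *
  (1 + rsum n (fun i => alpha N Q n (S i) * Rtrace N (Rmat_pow N Q (S i)))).

Lemma alpha_0_s (N : nat) (Q : nat -> nat -> R) (s : nat) : alpha N Q 0 s = 0.
Proof. reflexivity. Qed.

Lemma alpha_S_0 (N : nat) (Q : nat -> nat -> R) (n : nat) :
  alpha N Q (S n) 0 = alpha N Q n 0 + incr N Q n.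
Proof. unfold alpha, incr; simpl; unfold alpha; ring. Qed.

Lemma alpha_S_1 (N : nat) (Q : nat -> nat -> R) (n : nat) :
  alpha N Q (S n) 1 = (INR N - 2) / INR N * alpha N Q n 1 - incr N Q n.
Proof. unfold alpha, incr; simpl; unfold alpha; ring. Qed.

Lemma alpha_S_SS (N : nat) (Q : nat -> nat -> R) (n s : nat) :
  alpha N Q (S n) (S (S s)) =
  (INR N - 2) / INR N * alpha N Q n (S (S s)) + 2 / INR N * alpha N Q n (S s).
Proof. reflexivity. Qed.

Lemma alpha_support (N : nat) (Q : nat -> nat -> R) (n s : nat) :
  (n < s)%nat -> alpha N Q n s = 0.
Proof.
  revert s. induction n as [|n IH]; intros s Hs; [reflexivity|].
  destruct s as [|[|s]]; try lia.
  rewrite alpha_S_SS, !IH by lia. ring.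
Qed.

(** This is [R_n] with the powers [x^s] replaced by an arbitrary sequence [e], so that one recursion
    serves for numbers, matrix entries and traces. Then [lazy_shift] plays the role of
    multiplication by [(N-2+2x)/N]. *)
Definition pairing (N : nat) (Q : nat -> nat -> R) (n : nat) (e : nat -> R) : R :=
  rsum n (fun i => alpha N Q n (S i) * e (S i)).

Definition lazy_shift (N : nat) (e : nat -> R) (s : nat) : R :=
  (INR N - 2) / INR N * e s + 2 / INR N * e (S s).

Lemma pairing_S (N : nat) (Q : nat -> nat -> R) (n : nat) (e : nat -> R) :
  pairing N Q (S n) e =
  - incr N Q n * e 1%nat + pairing N Q n (lazy_shift N e).
Proof.
  unfold pairing. rewrite rsum_head, alpha_S_1.
  rewrite (rsum_ext n _ (fun i =>
     (INR N - 2) / INR N * (alpha N Q n (S (S i)) * e (S (S i)))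
     + 2 / INR N * (alpha N Q n (S i) * e (S (S i))))).
  2:{ intros. rewrite alpha_S_SS. ring. }
  rewrite rsum_plus, !rsum_scal.
  (* The sum over [1 <= s <= n] may be extended to [s = n+1], where [alpha] vanishes, before its
     first term is split off. *)
  pose proof (rsum_head n (fun i => alpha N Q n (S i) * e (S i))) as H.
  simpl in H. rewrite (alpha_support N Q n (S n)) in H by lia.
  rewrite (rsum_ext n (fun i => alpha N Q n (S i) * lazy_shift N e (S i)) (fun i =>
     (INR N - 2) / INR N * (alpha N Q n (S i) * e (S i))
     + 2 / INR N * (alpha N Q n (S i) * e (S (S i))))).
  2:{ intros. unfold lazy_shift. ring. }
  rewrite rsum_plus, !rsum_scal.
  replace (rsum n (fun i => alpha N Q n (S i) * e (S i))) with
    (alpha N Q n 1 * e 1%nat + rsum n (fun i => alpha N Q n (S (S i)) * e (S (S i))))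
    by (rewrite <- H; ring).
  ring.
Qed.

Lemma pairing_ext (N : nat) (Q : nat -> nat -> R) (n : nat) (e f : nat -> R) :
  (forall s, e s = f s) -> pairing N Q n e = pairing N Q n f.
Proof. intros H. apply rsum_ext. intros. now rewrite H. Qed.

Lemma incr_pairing (N : nat) (Q : nat -> nat -> R) (n : nat) :
  incr N Q n =
  2 / (INR N * INR N) * (1 + pairing N Q n (fun s => Rtrace N (Rmat_pow N Q s))).
Proof. reflexivity. Qed.

(** For symmetric [Q] this is the trace of [P^j Q^s], written as an entrywise inner product so that
    [symmetric_mul_adjoint] applies. *)
Definition mixed_trace (N : nat) (Q : nat -> nat -> R) (j s : nat) : R :=
  rsum N (fun i => rsum N (fun k =>
    Rmat_pow N (lazy N Q) j k i * Rmat_pow N Q s k i)).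

Lemma mixed_trace_0_l (N : nat) (Q : nat -> nat -> R) (s : nat) :
  mixed_trace N Q 0 s = Rtrace N (Rmat_pow N Q s).
Proof.
  apply rsum_ext. intros i Hi. simpl.
  rewrite (rsum_ext N _ (fun k => delta i k * Rmat_pow N Q s k i)).
  - now apply (rsum_delta_l N i (fun k => Rmat_pow N Q s k i)).
  - intros k _. now rewrite delta_sym.
Qed.

Lemma mixed_trace_0_r (N : nat) (Q : nat -> nat -> R) (j : nat) :
  mixed_trace N Q j 0 = Rtrace N (Rmat_pow N (lazy N Q) j).
Proof.
  apply rsum_ext. intros i Hi. simpl.
  rewrite (rsum_ext N _ (fun k => delta i k * Rmat_pow N (lazy N Q) j k i)).
  - now apply (rsum_delta_l N i (fun k => Rmat_pow N (lazy N Q) j k i)).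
  - intros k _. rewrite delta_sym. ring.
Qed.

Lemma mixed_trace_S (N : nat) (Q : nat -> nat -> R) (j s : nat) :
  symmetric N Q ->
  lazy_shift N (mixed_trace N Q j) s = mixed_trace N Q (S j) s.
Proof.
  intros Hsym. unfold lazy_shift, mixed_trace.
  rewrite <- !rsum_scal, <- rsum_plus. apply rsum_ext. intros i Hi.
  change (Rmat_pow N (lazy N Q) (S j))
    with (Rmat_mul N (lazy N Q) (Rmat_pow N (lazy N Q) j)).
  rewrite symmetric_mul_adjoint by (now apply lazy_symmetric).
  rewrite <- !rsum_scal, <- rsum_plus. apply rsum_ext. intros k Hk.
  rewrite lazy_mul by assumption. simpl. ring.
Qed.

(* [traced_conv j n] is the convolution [sum_(k <= n) incr k * tr P^(n - k + j)] for the lazy walk [P]. *)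
Fixpoint traced_conv (N : nat) (Q : nat -> nat -> R) (j n : nat) : R :=
  match n with
  | O => incr N Q 0 * mixed_trace N Q j 0
  | S m => traced_conv N Q (S j) m + incr N Q (S m) * mixed_trace N Q j 0
  end.

(** Unrolling the recursion gives [R_(n+1)(Q) = - sum_(k<=n) c_k P^(n-k) Q]. Multiplying by
    [(2/N) P^j], using [(2/N) Q = P - (N-2)/N] and taking traces leaves only powers of [P]. Each
    step of the recursion raises [j], hence the induction for all [j] at once. *)
Lemma pairing_mixed_trace (N : nat) (Q : nat -> nat -> R) (j n : nat) :
  (0 < N)%nat -> symmetric N Q ->
  2 / INR N * pairing N Q (S n) (mixed_trace N Q j) =
  (INR N - 2) / INR N * traced_conv N Q j n - traced_conv N Q (S j) n.
Proof.
  intros HN Hsym. assert (HN' : INR N <> 0) by (apply not_0_INR; lia).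
  assert (H1 : forall j, 2 / INR N * mixed_trace N Q j 1 =
     mixed_trace N Q (S j) 0 - (INR N - 2) / INR N * mixed_trace N Q j 0).
  { intros i. rewrite <- (mixed_trace_S N Q i 0 Hsym). unfold lazy_shift. ring. }
  revert j. induction n as [|n IH]; intros j; rewrite pairing_S;
    rewrite (pairing_ext N Q _ _ (mixed_trace N Q (S j)))
      by (intros; now apply mixed_trace_S);
    rewrite Rmult_plus_distr_l.
  - specialize (H1 j). cbn [traced_conv]. unfold pairing. simpl rsum.
    transitivity (- incr N Q 0 * (2 / INR N * mixed_trace N Q j 1)); [ring|].
    rewrite H1. ring.
  - rewrite IH. cbn [traced_conv].
    transitivity (- incr N Q (S n) * (2 / INR N * mixed_trace N Q j 1) +
      ((INR N - 2) / INR N * traced_conv N Q (S j) n - traced_conv N Q (S (S j)) n));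
      [ring|].
    rewrite H1. ring.
Qed.

Lemma incr_S (N : nat) (Q : nat -> nat -> R) (n : nat) :
  (0 < N)%nat -> symmetric N Q ->
  INR N * incr N Q (S n) =
  2 / INR N + (INR N - 2) / INR N * traced_conv N Q 0 n - traced_conv N Q 1 n.
Proof.
  intros HN Hsym. assert (HN' : INR N <> 0) by (apply not_0_INR; lia).
  pose proof (pairing_mixed_trace N Q 0 n HN Hsym) as H.
  rewrite incr_pairing.
  rewrite (pairing_ext N Q _ _ (mixed_trace N Q 0))
    by (intros; now rewrite mixed_trace_0_l).
  transitivity (2 / INR N + 2 / INR N * pairing N Q (S n) (mixed_trace N Q 0));
    [field; assumption|rewrite H; ring].
Qed.

(** Nonnegativity of the [c_k] transfers the monotonicity of the traces of [P^j] to the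
    convolutions, which in turn control the next coefficient. *)
Lemma incr_bounds (N : nat) (Q : nat -> nat -> R) (n : nat) :
  (4 <= N)%nat -> stochastic N Q -> symmetric N Q -> 0 <= incr N Q n <= 1.
Proof.
  intros HN Hst Hsym.
  assert (H4 : 4 <= INR N) by (apply (le_INR 4) in HN; simpl in HN; lra).
  assert (Hinv : 0 < 2 / INR N <= 1).
  { split; [apply Rdiv_lt_0_compat; lra|]. apply Rle_div_l; lra. }
  assert (Hb : (INR N - 2) / INR N = 1 - 2 / INR N) by (field; lra).
  assert (HstP : stochastic N (lazy N Q)) by (apply lazy_stochastic; trivial; lia).
  assert (Ht0 : mixed_trace N Q 0 0 = INR N).
  { rewrite mixed_trace_0_r. unfold Rtrace.
    rewrite (rsum_ext N _ (fun _ => 1)); [rewrite rsum_const; ring|].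
    intros i _. simpl. unfold delta. now destruct (Nat.eq_dec i i). }
  assert (Ht : forall j, 0 <= mixed_trace N Q (S j) 0 <= mixed_trace N Q j 0).
  { intros j. rewrite !mixed_trace_0_r. split.
    - apply rsum_nonneg. intros i Hi. now apply stochastic_pow_bounds.
    - apply Rtrace_pow_decr; trivial.
      + now apply lazy_symmetric.
      + intros v. now apply lazy_quad_nonneg. }
  assert (Hinc : forall c, 0 <= c -> INR N * c <= 1 -> 0 <= c <= 1).
  { intros c Hc Hc'. nra. }
  (* The induction carries the bound 1 on the convolution with [j = 0] and the monotonicity of the
     convolutions in [j]. *)
  enough (H : 0 <= incr N Q n /\ INR N * incr N Q n <= 1 /\ traced_conv N Q 0 n <= 1 /\
     (forall j, 0 <= traced_conv N Q (S j) n <= traced_conv N Q j n)).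
  { apply Hinc; tauto. }
  induction n as [|n (IH1 & IH2 & IH3 & IH4)].
  - assert (E : INR N * incr N Q 0 = 2 / INR N).
    { unfold incr. simpl. field. lra. }
    assert (P : 0 <= incr N Q 0).
    { unfold incr. simpl. rewrite Rplus_0_r, Rmult_1_r.
      apply Rlt_le, Rdiv_lt_0_compat; nra. }
    cbn [traced_conv]. rewrite Ht0.
    repeat split; try lra.
    + apply Rmult_le_pos; trivial; apply Ht.
    + apply Rmult_le_compat_l; trivial; apply Ht.
  - pose proof (incr_S N Q n ltac:(lia) Hsym) as E. rewrite Hb in E.
    pose proof (IH4 O) as H0.
    (* With [b = 2/N] and [T] the convolution for [j = 0], the right-hand side of [E] is at least
       [b (1 - T) >= 0]. *)
    assert (P : 0 <= incr N Q (S n)).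
    { apply (Rmult_le_reg_l (INR N)); [lra|]. rewrite E. nra. }
    (* The convolution for [j = 1] cancels, leaving [b + (1 - b) T], a convex combination of 1 and
       [T]. *)
    assert (U : traced_conv N Q 0 (S n) <= 1).
    { cbn [traced_conv]. rewrite Ht0. nra. }
    repeat split; trivial.
    + cbn [traced_conv] in U. rewrite Ht0 in U. lra.
    + cbn [traced_conv]. apply Rplus_le_le_0_compat; [apply IH4|].
      apply Rmult_le_pos; trivial; apply Ht.
    + cbn [traced_conv]. apply Rplus_le_compat; [apply IH4|].
      apply Rmult_le_compat_l; trivial; apply Ht.
Qed.

Lemma alpha_0_bounds (N : nat) (Q : nat -> nat -> R) (n : nat) :
  (4 <= N)%nat -> stochastic N Q -> symmetric N Q -> 0 <= alpha N Q n 0 <= INR n.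
Proof.
  intros HN Hst Hsym. induction n as [|n IH].
  - rewrite alpha_0_s. simpl. lra.
  - rewrite alpha_S_0, S_INR. pose proof (incr_bounds N Q n HN Hst Hsym). lra.
Qed.

(** The recursion averages the row with its shift, with weights [1 - b] and [b], which does not
    increase the absolute sum; the source term [- c_n] adds at most 1. *)
Lemma alpha_row_abs_sum (N : nat) (Q : nat -> nat -> R) (n : nat) :
  (4 <= N)%nat -> stochastic N Q -> symmetric N Q ->
  rsum n (fun i => Rabs (alpha N Q n (S i))) <= INR n.
Proof.
  intros HN Hst Hsym.
  assert (H4 : 4 <= INR N) by (apply (le_INR 4) in HN; simpl in HN; lra).
  assert (Hinv : 0 < 2 / INR N <= 1).
  { split; [apply Rdiv_lt_0_compat; lra|]. apply Rle_div_l; lra. }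
  assert (Hb : (INR N - 2) / INR N = 1 - 2 / INR N) by (field; lra).
  set (b := 2 / INR N) in *.
  induction n as [|n IH]; [simpl; lra|].
  rewrite rsum_head, S_INR, alpha_S_1, Hb.
  pose proof (incr_bounds N Q n HN Hst Hsym) as Hi.
  assert (H1 : Rabs ((1 - b) * alpha N Q n 1 - incr N Q n) <=
               (1 - b) * Rabs (alpha N Q n 1) + 1).
  { unfold Rminus at 1. eapply Rle_trans; [apply Rabs_triang|].
    rewrite Rabs_mult, Rabs_Ropp, (Rabs_pos_eq (1 - b)), (Rabs_pos_eq (incr N Q n));
      lra. }
  assert (H2 : rsum n (fun i => Rabs (alpha N Q (S n) (S (S i)))) <=
     (1 - b) * rsum n (fun i => Rabs (alpha N Q n (S (S i))))
     + b * rsum n (fun i => Rabs (alpha N Q n (S i)))).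
  { rewrite <- !rsum_scal, <- rsum_plus. apply rsum_le. intros i _.
    rewrite alpha_S_SS, Hb. fold b. eapply Rle_trans; [apply Rabs_triang|].
    rewrite !Rabs_mult, (Rabs_pos_eq (1 - b)), (Rabs_pos_eq b); lra. }
  pose proof (rsum_head n (fun i => Rabs (alpha N Q n (S i)))) as H.
  simpl in H. rewrite (alpha_support N Q n (S n)), Rabs_R0 in H by lia.
  nra.
Qed.

(** * Complex numbers and complex series *)

Lemma Cplx_ext (z w : Cplx) : Re z = Re w -> Im z = Im w -> z = w.
Proof. destruct z, w; simpl; congruence. Qed.

Lemma Cplx_ring_theory : ring_theory Czero Cone Cadd Cmul Csub Copp eq.
Proof. constructor; intros; apply Cplx_ext; simpl; ring. Qed.

Lemma Re_Im_sqr_pos (z : Cplx) : z <> Czero -> 0 < Re z * Re z + Im z * Im z.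
Proof.
  intros Hz. destruct z as [a b]; simpl.
  destruct (Req_dec a 0) as [->|Ha]; [|nra].
  destruct (Req_dec b 0) as [->|Hb]; [|nra].
  now elim Hz.
Qed.

Lemma Cplx_field_theory :
  field_theory Czero Cone Cadd Cmul Csub Copp Cdiv Cinv eq.
Proof.
  constructor.
  - exact Cplx_ring_theory.
  - intros H. apply (f_equal Re) in H. simpl in H. lra.
  - reflexivity.
  - intros z Hz. apply Re_Im_sqr_pos in Hz.
    apply Cplx_ext; simpl; field; lra.
Qed.

Add Field Cplx_field : Cplx_field_theory.

Lemma RtoC_add (a b : R) : RtoC (a + b) = Cadd (RtoC a) (RtoC b).
Proof. apply Cplx_ext; simpl; ring. Qed.

Lemma RtoC_mul (a b : R) : RtoC (a * b) = Cmul (RtoC a) (RtoC b).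
Proof. apply Cplx_ext; simpl; ring. Qed.

Lemma RtoC_sub (a b : R) : RtoC (a - b) = Csub (RtoC a) (RtoC b).
Proof. apply Cplx_ext; simpl; ring. Qed.

Lemma RtoC_2 : RtoC 2 = Cadd Cone Cone.
Proof. apply Cplx_ext; simpl; ring. Qed.

Lemma RtoC_neq_0 (a : R) : a <> 0 -> RtoC a <> Czero.
Proof. intros Ha H. apply (f_equal Re) in H. simpl in H. congruence. Qed.

Lemma RtoC_div (a b : R) : b <> 0 -> RtoC (a / b) = Cdiv (RtoC a) (RtoC b).
Proof. intros Hb. apply Cplx_ext; simpl; field; nra. Qed.

Lemma Cnorm_nonneg (z : Cplx) : 0 <= Cnorm z.
Proof. apply sqrt_pos. Qed.

Lemma Cnorm_sqr (z : Cplx) : Cnorm z * Cnorm z = Re z * Re z + Im z * Im z.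
Proof. apply sqrt_sqrt. nra. Qed.

Lemma Cnorm_mul (z w : Cplx) : Cnorm (Cmul z w) = Cnorm z * Cnorm w.
Proof.
  unfold Cnorm. rewrite <- sqrt_mult by nra. f_equal. simpl. ring.
Qed.

Lemma Cnorm_RtoC (a : R) : Cnorm (RtoC a) = Rabs a.
Proof.
  unfold Cnorm. simpl. rewrite <- sqrt_Rsqr_abs. f_equal. unfold Rsqr. ring.
Qed.

Lemma Cnorm_Cone : Cnorm Cone = 1.
Proof. unfold Cone. rewrite Cnorm_RtoC. apply Rabs_R1. Qed.

Lemma Cnorm_pow (z : Cplx) (n : nat) : Cnorm (Cpow z n) = Cnorm z ^ n.
Proof.
  induction n as [|n IH]; simpl; [apply Cnorm_Cone|]. now rewrite Cnorm_mul, IH.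
Qed.

Lemma Cnorm_triangle (z w : Cplx) : Cnorm (Cadd z w) <= Cnorm z + Cnorm w.
Proof.
  pose proof (Cnorm_nonneg z). pose proof (Cnorm_nonneg w).
  apply Rsqr_incr_0_var; [|lra]. unfold Rsqr.
  rewrite Cnorm_sqr.
  assert (Re z * Re w + Im z * Im w <= Cnorm z * Cnorm w).
  { rewrite <- Cnorm_mul. eapply Rle_trans; [apply Rle_abs|].
    unfold Cnorm. rewrite <- sqrt_Rsqr_abs. apply sqrt_le_1_alt.
    (* Cauchy-Schwarz by Lagrange's identity: the square of [S] is what separates [|z|^2 |w|^2] from
       the squared inner product. *)
    unfold Rsqr. simpl. pose proof (Rle_0_sqr (Re z * Im w - Im z * Re w)) as S.
    unfold Rsqr in S. nra. }
  pose proof (Cnorm_sqr z). pose proof (Cnorm_sqr w). simpl. nra.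
Qed.

Lemma Re_le_Cnorm (z : Cplx) : Rabs (Re z) <= Cnorm z.
Proof.
  unfold Cnorm. rewrite <- sqrt_Rsqr_abs. apply sqrt_le_1_alt. unfold Rsqr. nra.
Qed.

Lemma Im_le_Cnorm (z : Cplx) : Rabs (Im z) <= Cnorm z.
Proof.
  unfold Cnorm. rewrite <- sqrt_Rsqr_abs. apply sqrt_le_1_alt. unfold Rsqr. nra.
Qed.

Lemma Cnorm_le_abs (z : Cplx) : Cnorm z <= Rabs (Re z) + Rabs (Im z).
Proof.
  replace z with (Cadd (RtoC (Re z)) (Cmul (mkC 0 1) (RtoC (Im z)))) at 1
    by (apply Cplx_ext; simpl; ring).
  eapply Rle_trans; [apply Cnorm_triangle|].
  rewrite Cnorm_mul, !Cnorm_RtoC. unfold Cnorm at 1. simpl.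
  replace (0 * 0 + 1 * 1) with 1 by ring. rewrite sqrt_1. lra.
Qed.

Lemma csum_components (n : nat) (f : nat -> Cplx) :
  csum n f = mkC (rsum n (fun i => Re (f i))) (rsum n (fun i => Im (f i))).
Proof. induction n as [|n IH]; simpl; [reflexivity|]. now rewrite IH. Qed.

Lemma csum_ext (n : nat) (f g : nat -> Cplx) :
  (forall i, (i < n)%nat -> f i = g i) -> csum n f = csum n g.
Proof.
  intros H. rewrite !csum_components.
  f_equal; apply rsum_ext; intros i Hi; now rewrite H.
Qed.

Lemma csum_plus (n : nat) (f g : nat -> Cplx) :
  csum n (fun i => Cadd (f i) (g i)) = Cadd (csum n f) (csum n g).
Proof. induction n as [|n IH]; simpl; [|rewrite IH]; ring. Qed.

Lemma csum_scal (n : nat) (a : Cplx) (f : nat -> Cplx) :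
  csum n (fun i => Cmul a (f i)) = Cmul a (csum n f).
Proof. induction n as [|n IH]; simpl; [|rewrite IH]; ring. Qed.

Lemma csum_exchange (n m : nat) (f : nat -> nat -> Cplx) :
  csum n (fun i => csum m (fun j => f i j)) =
  csum m (fun j => csum n (fun i => f i j)).
Proof.
  rewrite !csum_components. f_equal.
  - rewrite (rsum_ext n _ (fun i => rsum m (fun j => Re (f i j)))).
    + rewrite rsum_exchange. apply rsum_ext. intros. now rewrite csum_components.
    + intros. now rewrite csum_components.
  - rewrite (rsum_ext n _ (fun i => rsum m (fun j => Im (f i j)))).
    + rewrite rsum_exchange. apply rsum_ext. intros. now rewrite csum_components.
    + intros. now rewrite csum_components.
Qed.

Lemma csum_RtoC (n : nat) (f : nat -> R) :
  csum n (fun i => RtoC (f i)) = RtoC (rsum n f).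
Proof.
  induction n as [|n IH]; simpl; [reflexivity|]. now rewrite IH, RtoC_add.
Qed.

Lemma csum_head (n : nat) (f : nat -> Cplx) :
  csum (S n) f = Cadd (f O) (csum n (fun i => f (S i))).
Proof. rewrite !csum_components. apply Cplx_ext; simpl Re; simpl Im; apply rsum_head. Qed.

Lemma csum_widen (m n : nat) (f : nat -> Cplx) :
  (m <= n)%nat -> (forall i, (m <= i)%nat -> f i = Czero) -> csum n f = csum m f.
Proof.
  intros Hmn Hf. rewrite !csum_components.
  f_equal; apply rsum_widen; trivial; intros i Hi; now rewrite Hf.
Qed.

Lemma csum_delta_l (n i : nat) (f : nat -> Cplx) :
  (i < n)%nat -> csum n (fun k => Cmul (RtoC (delta i k)) (f k)) = f i.
Proof.
  intros Hi. rewrite csum_components. apply Cplx_ext; simpl.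
  - rewrite <- (rsum_delta_l n i (fun k => Re (f k))) by assumption.
    apply rsum_ext. intros. ring.
  - rewrite <- (rsum_delta_l n i (fun k => Im (f k))) by assumption.
    apply rsum_ext. intros. ring.
Qed.

Lemma Cnorm_csum (n : nat) (f : nat -> Cplx) :
  Cnorm (csum n f) <= rsum n (fun i => Cnorm (f i)).
Proof.
  induction n as [|n IH]; simpl.
  - unfold Czero. rewrite Cnorm_RtoC, Rabs_R0. lra.
  - eapply Rle_trans; [apply Cnorm_triangle|lra].
Qed.

(** * Complex series, by real and imaginary parts *)

Definition csums (u : nat -> Cplx) (l : Cplx) : Prop :=
  is_series (fun n => Re (u n)) (Re l) /\ is_series (fun n => Im (u n)) (Im l).

(** [Series] is total, so this value is meaningful only together with a convergence proof such as
    [csums_dominated]. *)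
Definition Csum (u : nat -> Cplx) : Cplx :=
  mkC (Series (fun n => Re (u n))) (Series (fun n => Im (u n))).

Lemma csums_unique (u : nat -> Cplx) (l l' : Cplx) :
  csums u l -> csums u l' -> l = l'.
Proof.
  intros [H1 H2] [H3 H4]. apply is_series_unique in H1, H2, H3, H4.
  apply Cplx_ext; congruence.
Qed.

Lemma csums_ext (u v : nat -> Cplx) (l : Cplx) :
  (forall n, u n = v n) -> csums u l -> csums v l.
Proof.
  intros H [H1 H2]. split.
  - apply (is_series_ext (fun n => Re (u n))); trivial. intros; now rewrite H.
  - apply (is_series_ext (fun n => Im (u n))); trivial. intros; now rewrite H.
Qed.

Lemma csums_plus (u v : nat -> Cplx) (l m : Cplx) :
  csums u l -> csums v m -> csums (fun n => Cadd (u n) (v n)) (Cadd l m).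
Proof.
  intros [H1 H2] [H3 H4]. split; simpl.
  - exact (is_series_plus _ _ _ _ H1 H3).
  - exact (is_series_plus _ _ _ _ H2 H4).
Qed.

Lemma csums_scal (a : Cplx) (u : nat -> Cplx) (l : Cplx) :
  csums u l -> csums (fun n => Cmul a (u n)) (Cmul a l).
Proof.
  intros [H1 H2]. split; simpl.
  - exact (is_series_minus _ _ _ _ (is_series_scal (Re a) _ _ H1)
             (is_series_scal (Im a) _ _ H2)).
  - exact (is_series_plus _ _ _ _ (is_series_scal (Re a) _ _ H2)
             (is_series_scal (Im a) _ _ H1)).
Qed.

Lemma csums_zero : csums (fun _ => Czero) Czero.
Proof.
  assert (H : is_series (fun _ : nat => 0) 0).
  { change (is_lim_seq (sum_n (fun _ => 0)) 0).
    apply (is_lim_seq_ext (fun _ => 0)); [|apply is_lim_seq_const].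
    intros n. rewrite sum_n_const. ring. }
  split; exact H.
Qed.

Lemma csums_csum (N : nat) (u : nat -> nat -> Cplx) (l : nat -> Cplx) :
  (forall k, (k < N)%nat -> csums (u k) (l k)) ->
  csums (fun n => csum N (fun k => u k n)) (csum N l).
Proof.
  induction N as [|N IH]; intros H; simpl; [apply csums_zero|].
  apply csums_plus; [apply IH; intros; apply H|apply H]; lia.
Qed.

(** With uniqueness of sums, this turns a recursion in [n] into a linear equation for the generating
    function. *)
Lemma csums_shift (u : nat -> Cplx) (l : Cplx) :
  csums (fun n => u (S n)) l -> csums u (Cadd (u O) l).
Proof.
  intros [H1 H2]. split.
  - apply (is_series_decr_1 (fun n => Re (u n))).
    replace (plus _ _) with (Re l) by (unfold plus, opp; simpl; ring). exact H1.
  - apply (is_series_decr_1 (fun n => Im (u n))).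
    replace (plus _ _) with (Im l) by (unfold plus, opp; simpl; ring). exact H2.
Qed.

Lemma csums_dominated (u : nat -> Cplx) (b : nat -> R) :
  ex_series b -> (forall n, Cnorm (u n) <= b n) -> csums u (Csum u).
Proof.
  intros Hb Hu. split; apply Series_correct.
  - apply (ex_series_le (fun n => Re (u n)) b); trivial. intros n.
    eapply Rle_trans; [apply Re_le_Cnorm|apply Hu].
  - apply (ex_series_le (fun n => Im (u n)) b); trivial. intros n.
    eapply Rle_trans; [apply Im_le_Cnorm|apply Hu].
Qed.

Lemma rsum_sum_n (f : nat -> R) (n : nat) : rsum (S n) f = sum_n f n.
Proof.
  induction n as [|n IH].
  - rewrite sum_O. simpl. ring.
  - rewrite sum_Sn, <- IH. reflexivity.
Qed.

Lemma is_series_rsum (f : nat -> R) (l eps : R) :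
  is_series f l -> 0 < eps ->
  exists K0, forall K, (K >= K0)%nat -> Rabs (rsum K f - l) < eps.
Proof.
  intros H He. assert (H' : is_lim_seq (sum_n f) l) by exact H.
  apply is_lim_seq_spec in H'. destruct (H' (mkposreal eps He)) as [K0 HK].
  (* [rsum K] stops at index [K - 1] whereas [sum_n] includes its last index, so the threshold moves
     by one. *)
  exists (S K0). intros [|K] HKK; [lia|]. rewrite rsum_sum_n.
  apply HK. lia.
Qed.

Lemma csums_Ccv (u : nat -> Cplx) (l : Cplx) :
  csums u l -> Ccv (fun K => csum K u) l.
Proof.
  intros [H1 H2] eps He.
  destruct (is_series_rsum _ _ (eps / 2) H1 ltac:(lra)) as [K1 HK1].
  destruct (is_series_rsum _ _ (eps / 2) H2 ltac:(lra)) as [K2 HK2].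
  exists (max K1 K2). intros K HK.
  specialize (HK1 K ltac:(lia)). specialize (HK2 K ltac:(lia)).
  eapply Rle_lt_trans; [apply Cnorm_le_abs|].
  rewrite csum_components. simpl. unfold Rminus in *. lra.
Qed.

Lemma rsum_arith_geom_le (r : R) (K : nat) :
  0 <= r < 1 -> rsum K (fun n => (INR n + 1) * r ^ n) <= / ((1 - r) * (1 - r)).
Proof.
  intros Hr.
  (* Exact form of the partial sum, with the remainder made explicit; the remainder is
     nonnegative. *)
  assert (E : rsum K (fun n => (INR n + 1) * r ^ n) * ((1 - r) * (1 - r)) =
              1 - r ^ K * (1 + INR K * (1 - r))).
  { induction K as [|K IH]; [simpl; ring|].
    rewrite S_INR. simpl rsum. rewrite Rmult_plus_distr_r, IH. simpl. ring. }
  assert (0 <= r ^ K) by (apply pow_le; lra).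
  assert (0 <= INR K) by apply pos_INR.
  assert (Hp : 0 < (1 - r) * (1 - r)) by nra.
  apply (Rmult_le_reg_r ((1 - r) * (1 - r))); [assumption|].
  rewrite E, Rinv_l by lra.
  assert (0 <= r ^ K * (1 + INR K * (1 - r))) by (apply Rmult_le_pos; nra).
  lra.
Qed.

Lemma ex_series_arith_geom (r : R) :
  0 <= r < 1 -> ex_series (fun n => (INR n + 1) * r ^ n).
Proof.
  intros Hr.
  assert (H : ex_finite_lim_seq (sum_n (fun n => (INR n + 1) * r ^ n))).
  { apply (ex_finite_lim_seq_incr _ (/ ((1 - r) * (1 - r)))).
    - intros n. rewrite <- !rsum_sum_n. cbn [rsum].
      assert (0 <= (INR (S n) + 1) * r ^ S n).
      { apply Rmult_le_pos; [|apply pow_le; lra]. pose proof (pos_INR (S n)). lra. }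
      lra.
    - intros n. rewrite <- rsum_sum_n. now apply rsum_arith_geom_le. }
  exact H.
Qed.

(** The bound [n + 1] covers every coefficient sequence used below: constants, [c_n], [alpha(n,0)],
    entries of [P^n] and pairings. *)
Lemma csums_power_series (zeta : Cplx) (a : nat -> Cplx) :
  Cnorm zeta < 1 -> (forall n, Cnorm (a n) <= INR n + 1) ->
  csums (fun n => Cmul (Cpow zeta n) (a n)) (Csum (fun n => Cmul (Cpow zeta n) (a n))).
Proof.
  intros Hz Ha. apply (csums_dominated _ (fun n => (INR n + 1) * Cnorm zeta ^ n)).
  - apply ex_series_arith_geom. split; [apply Cnorm_nonneg|assumption].
  - intros n. rewrite Cnorm_mul, Cnorm_pow, Rmult_comm.
    apply Rmult_le_compat_r; trivial. apply pow_le, Cnorm_nonneg.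
Qed.

(** * The resolvent *)

Lemma Mzeta_lazy (N : nat) (Q : nat -> nat -> R) (zeta : Cplx) (i j : nat) :
  (0 < N)%nat ->
  Mzeta N Q zeta i j =
  Cmul (RtoC (INR N))
    (Csub (RtoC (delta i j)) (Cmul zeta (RtoC (lazy N Q i j)))).
Proof.
  intros HN. assert (INR N <> 0) by (apply not_0_INR; lia).
  unfold Mzeta, lazy. apply Cplx_ext; simpl; field; assumption.
Qed.

Lemma Mzeta_mul (N : nat) (Q : nat -> nat -> R) (zeta : Cplx)
  (Y : nat -> nat -> Cplx) (i j : nat) :
  (i < N)%nat ->
  Cmat_mul N (Mzeta N Q zeta) Y i j =
  Cmul (RtoC (INR N)) (Csub (Y i j)
    (Cmul zeta (csum N (fun k => Cmul (RtoC (lazy N Q i k)) (Y k j))))).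
Proof.
  intros Hi. unfold Cmat_mul.
  rewrite (csum_ext N _ (fun k => Cadd
    (Cmul (RtoC (INR N)) (Cmul (RtoC (delta i k)) (Y k j)))
    (Cmul (Copp (Cmul (RtoC (INR N)) zeta)) (Cmul (RtoC (lazy N Q i k)) (Y k j))))).
  - rewrite csum_plus, !csum_scal, (csum_delta_l N i (fun k => Y k j)) by assumption.
    ring.
  - intros k _. rewrite Mzeta_lazy by lia. ring.
Qed.

(** The inverse is the Neumann series [(1/N) sum_n zeta^n P^n], which converges entrywise because
    the entries of [P^n] lie in [[0,1]]. *)
Lemma resolvent_exists (N : nat) (Q : nat -> nat -> R) (zeta : Cplx) :
  (2 <= N)%nat -> stochastic N Q -> symmetric N Q -> Cnorm zeta < 1 ->
  exists X, Cmat_inverse N (Mzeta N Q zeta) X.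
Proof.
  intros HN Hst Hsym Hz.
  assert (HN0 : RtoC (INR N) <> Czero) by (apply RtoC_neq_0, not_0_INR; lia).
  set (a := fun i j n => RtoC (Rmat_pow N (lazy N Q) n i j)).
  set (G := fun i j => Csum (fun n => Cmul (Cpow zeta n) (a i j n))).
  assert (HG : forall i j, (i < N)%nat ->
     csums (fun n => Cmul (Cpow zeta n) (a i j n)) (G i j)).
  { intros i j Hi. apply csums_power_series; trivial. intros n.
    unfold a. rewrite Cnorm_RtoC.
    pose proof (stochastic_pow_bounds N (lazy N Q) n i j
      (lazy_stochastic N Q HN Hst) Hi).
    rewrite Rabs_pos_eq by lra. pose proof (pos_INR n). lra. }
  assert (HGsym : forall i j, (i < N)%nat -> (j < N)%nat -> G i j = G j i).
  { intros i j Hi Hj. apply (csums_unique (fun n => Cmul (Cpow zeta n) (a i j n)));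
      [now apply HG|].
    apply (csums_ext (fun n => Cmul (Cpow zeta n) (a j i n))); [|now apply HG].
    intros n. unfold a. f_equal. f_equal.
    apply symmetric_pow; trivial. now apply lazy_symmetric. }
  (* Splitting off the term [n = 0] gives [G = 1 + zeta P G], so that [G / N] is a right inverse. *)
  assert (HGeq : forall i j, (i < N)%nat ->
    G i j = Cadd (RtoC (delta i j))
      (Cmul zeta (csum N (fun k => Cmul (RtoC (lazy N Q i k)) (G k j))))).
  { intros i j Hi. apply (csums_unique (fun n => Cmul (Cpow zeta n) (a i j n)));
      [now apply HG|].
    replace (RtoC (delta i j)) with (Cmul (Cpow zeta 0) (a i j O))
      by (unfold a; simpl; ring).
    apply (csums_shift (fun n => Cmul (Cpow zeta n) (a i j n))).
    apply (csums_ext (fun n => Cmul zeta (csum N (fun k =>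
       Cmul (RtoC (lazy N Q i k)) (Cmul (Cpow zeta n) (a k j n)))))).
    - intros n. unfold a. simpl Cpow.
      change (Rmat_pow N (lazy N Q) (S n) i j) with
        (rsum N (fun k => lazy N Q i k * Rmat_pow N (lazy N Q) n k j)).
      rewrite <- csum_RtoC, <- !csum_scal. apply csum_ext. intros k _.
      rewrite RtoC_mul. ring.
    - apply csums_scal. apply (csums_csum N (fun k n =>
        Cmul (RtoC (lazy N Q i k)) (Cmul (Cpow zeta n) (a k j n)))).
      intros k Hk. apply csums_scal. now apply HG. }
  set (X := fun i j => Cdiv (G i j) (RtoC (INR N))).
  assert (HR : forall i j, (i < N)%nat ->
     Cmat_mul N (Mzeta N Q zeta) X i j = RtoC (delta i j)).
  { intros i j Hi. rewrite Mzeta_mul by assumption. unfold X.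
    rewrite (csum_ext N _ (fun k => Cmul (Cinv (RtoC (INR N)))
       (Cmul (RtoC (lazy N Q i k)) (G k j)))) by (intros; unfold Cdiv; ring).
    rewrite csum_scal, (HGeq i j Hi). field. assumption. }
  exists X. intros i j Hi Hj. split; [now apply HR|].
  (* Both matrices are symmetric, so the product in the other order is the transpose of the one
     already computed. *)
  rewrite delta_sym, <- HR by assumption. apply csum_ext. intros k Hk.
  unfold X. rewrite (HGsym i k), (Mzeta_lazy N Q zeta k j), (Mzeta_lazy N Q zeta j k) by (trivial; lia).
  rewrite (delta_sym k j), (lazy_symmetric N Q Hsym k j Hk Hj). ring.
Qed.

(** Multiply [A Y = Z] by the left inverse [X]; only column [j] is involved. *)
Lemma resolvent_solve (N : nat) (A X Y Z : nat -> nat -> Cplx) (i j : nat) :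
  Cmat_inverse N A X -> (i < N)%nat ->
  (forall k, (k < N)%nat -> Cmat_mul N A Y k j = Z k j) ->
  Y i j = Cmat_mul N X Z i j.
Proof.
  intros HX Hi HY. unfold Cmat_mul at 1.
  rewrite (csum_ext N _ (fun k => csum N (fun l => Cmul (Cmul (X i k) (A k l)) (Y l j)))).
  - rewrite csum_exchange.
    rewrite <- (csum_delta_l N i (fun l => Y l j)) at 1 by assumption.
    apply csum_ext. intros l Hl.
    destruct (HX i l Hi Hl) as [_ <-]. unfold Cmat_mul.
    rewrite (csum_ext N (fun i0 => Cmul (Cmul (X i i0) (A i0 l)) (Y l j))
      (fun k => Cmul (Y l j) (Cmul (X i k) (A k l)))) by (intros; ring).
    rewrite csum_scal. ring.
  - intros k Hk. rewrite <- HY by assumption. unfold Cmat_mul.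
    rewrite <- csum_scal. apply csum_ext. intros. ring.
Qed.

(** Trace of [X (N - zeta (N-2+2Q)) = 1], expanded in [X] and [X Q]. *)
Lemma Ctrace_resolvent (N : nat) (Q : nat -> nat -> R) (zeta : Cplx)
  (X : nat -> nat -> Cplx) :
  Cmat_inverse N (Mzeta N Q zeta) X ->
  Cadd (Cmul (Csub (RtoC (INR N)) (Cmul zeta (RtoC (INR N - 2)))) (Ctrace N X))
    (Cmul (Cmul (Copp (RtoC 2)) zeta)
       (Ctrace N (Cmat_mul N X (fun i j => RtoC (Q i j))))) =
  RtoC (INR N).
Proof.
  intros HX.
  transitivity (Ctrace N (Cmat_mul N X (Mzeta N Q zeta))).
  - unfold Ctrace. rewrite <- !csum_scal, <- csum_plus. apply csum_ext.
    intros i Hi. unfold Cmat_mul.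
    rewrite <- (csum_delta_l N i (fun k => X i k)) at 1 by assumption.
    rewrite <- !csum_scal, <- csum_plus. apply csum_ext. intros k _.
    unfold Mzeta. rewrite (delta_sym k i). apply Cplx_ext; simpl; ring.
  - transitivity (csum N (fun i => RtoC 1)).
    + apply csum_ext. intros i Hi. destruct (HX i i Hi Hi) as [_ ->].
      unfold delta. now destruct (Nat.eq_dec i i).
    + rewrite csum_RtoC, rsum_const. f_equal. ring.
Qed.

(** * The generating function *)

Definition Cpairing (N : nat) (Q : nat -> nat -> R) (n : nat) (e : nat -> Cplx) : Cplx :=
  csum n (fun i => Cmul (RtoC (alpha N Q n (S i))) (e (S i))).

Definition Clazy_shift (N : nat) (e : nat -> Cplx) (s : nat) : Cplx :=
  Cadd (Cmul (RtoC ((INR N - 2) / INR N)) (e s)) (Cmul (RtoC (2 / INR N)) (e (S s))).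

Lemma Cpairing_components (N : nat) (Q : nat -> nat -> R) (n : nat) (e : nat -> Cplx) :
  Cpairing N Q n e =
  mkC (pairing N Q n (fun s => Re (e s))) (pairing N Q n (fun s => Im (e s))).
Proof.
  unfold Cpairing. rewrite csum_components.
  f_equal; apply rsum_ext; intros; simpl; ring.
Qed.

Lemma Cpairing_S (N : nat) (Q : nat -> nat -> R) (n : nat) (e : nat -> Cplx) :
  Cpairing N Q (S n) e =
  Cadd (Cmul (Copp (RtoC (incr N Q n))) (e 1%nat)) (Cpairing N Q n (Clazy_shift N e)).
Proof.
  rewrite !Cpairing_components, !pairing_S.
  rewrite (pairing_ext N Q n (fun s => Re (Clazy_shift N e s))
    (lazy_shift N (fun s => Re (e s)))) by (intros; unfold lazy_shift; simpl; ring).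
  rewrite (pairing_ext N Q n (fun s => Im (Clazy_shift N e s))
    (lazy_shift N (fun s => Im (e s)))) by (intros; unfold lazy_shift; simpl; ring).
  apply Cplx_ext; simpl; ring.
Qed.

Lemma Cpairing_ext (N : nat) (Q : nat -> nat -> R) (n : nat) (e f : nat -> Cplx) :
  (forall s, e s = f s) -> Cpairing N Q n e = Cpairing N Q n f.
Proof. intros H. apply csum_ext. intros. now rewrite H. Qed.

Lemma Cpairing_scal (N : nat) (Q : nat -> nat -> R) (n : nat) (a : Cplx) (e : nat -> Cplx) :
  Cpairing N Q n (fun s => Cmul a (e s)) = Cmul a (Cpairing N Q n e).
Proof. unfold Cpairing. rewrite <- csum_scal. apply csum_ext. intros. ring. Qed.

Lemma Cpairing_csum (N : nat) (Q : nat -> nat -> R) (n M : nat) (e : nat -> nat -> Cplx) :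
  Cpairing N Q n (fun s => csum M (fun k => e k s)) =
  csum M (fun k => Cpairing N Q n (e k)).
Proof.
  unfold Cpairing. rewrite csum_exchange. apply csum_ext. intros.
  now rewrite csum_scal.
Qed.

Lemma Cnorm_Cpairing (N : nat) (Q : nat -> nat -> R) (n : nat) (e : nat -> Cplx) :
  (4 <= N)%nat -> stochastic N Q -> symmetric N Q ->
  (forall s, Cnorm (e s) <= 1) -> Cnorm (Cpairing N Q n e) <= INR n.
Proof.
  intros HN Hst Hsym He.
  eapply Rle_trans; [apply Cnorm_csum|].
  eapply Rle_trans; [|now apply (alpha_row_abs_sum N Q n)].
  apply rsum_le. intros i _. rewrite Cnorm_mul, Cnorm_RtoC.
  rewrite <- (Rmult_1_r (Rabs _)) at 2.
  apply Rmult_le_compat_l; [apply Rabs_pos|apply He].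
Qed.

(** Row [n] is supported on [s <= n], so a square partial sum of size [K > n] contains all of it;
    the double series becomes a simple series in [n]. *)
Lemma Gterm_sum (N : nat) (Q : nat -> nat -> R) (zeta q : Cplx) (n K : nat) :
  (n < K)%nat ->
  csum K (fun s => Gterm N Q zeta q n s) =
  Cmul (Cpow zeta n) (Cadd (RtoC (alpha N Q n 0)) (Cpairing N Q n (Cpow q))).
Proof.
  intros Hn. rewrite (csum_widen (S n)); [|lia|].
  - rewrite csum_head. unfold Cpairing, Gterm.
    rewrite (csum_ext n _ (fun i => Cmul (Cpow zeta n)
      (Cmul (RtoC (alpha N Q n (S i))) (Cpow q (S i))))) by (intros; ring).
    rewrite csum_scal. simpl Cpow. ring.
  - intros i Hi. unfold Gterm. rewrite alpha_support by lia.
    change (RtoC 0) with Czero. ring.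
Qed.

Lemma Gabs_partial_le (N : nat) (Q : nat -> nat -> R) (zeta q : Cplx) (K : nat) :
  (4 <= N)%nat -> stochastic N Q -> symmetric N Q -> Cnorm zeta < 1 -> Cnorm q <= 1 ->
  Gabs_partial N Q zeta q K <= 2 / ((1 - Cnorm zeta) * (1 - Cnorm zeta)).
Proof.
  intros HN Hst Hsym Hz Hq.
  pose proof (Cnorm_nonneg zeta) as Hz0. pose proof (Cnorm_nonneg q) as Hq0.
  eapply Rle_trans;
    [|apply Rmult_le_compat_l; [lra|now apply (rsum_arith_geom_le _ K)]].
  rewrite <- rsum_scal. apply rsum_le. intros n Hn.
  assert (Hp : 0 <= Cnorm zeta ^ n) by (apply pow_le; lra).
  (* The factor 2 in the bound arises because [alpha(n,0)] and the terms with [s >= 1] each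
     contribute at most [n]. *)
  apply Rle_trans with
    (Cnorm zeta ^ n * rsum K (fun s => Rabs (alpha N Q n s))).
  - rewrite <- rsum_scal. apply rsum_le. intros s _. unfold Gterm.
    rewrite !Cnorm_mul, !Cnorm_pow, Cnorm_RtoC.
    apply Rmult_le_compat_r; [apply Rabs_pos|].
    rewrite <- Rmult_1_r. apply Rmult_le_compat_l; trivial.
    rewrite <- (pow1 s). now apply pow_incr.
  - rewrite (rsum_widen (S n)); [|lia|].
    + rewrite rsum_head.
      pose proof (alpha_row_abs_sum N Q n HN Hst Hsym).
      pose proof (alpha_0_bounds N Q n HN Hst Hsym).
      rewrite (Rabs_pos_eq (alpha N Q n 0)) by lra. nra.
    + intros s Hs. rewrite alpha_support by lia. apply Rabs_R0.
Qed.

(** Generating-function form of [Cpairing_S]; the term [n = 0] is an empty sum. It is applied to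
    [e_s = q^s] and to the entries of [Q^s]. *)
Lemma pairing_series (N : nat) (Q : nat -> nat -> R) (zeta c l l' : Cplx)
  (e : nat -> Cplx) :
  csums (fun n => Cmul (Cpow zeta n) (RtoC (incr N Q n))) c ->
  csums (fun n => Cmul (Cpow zeta n) (Cpairing N Q n e)) l ->
  csums (fun n => Cmul (Cpow zeta n) (Cpairing N Q n (Clazy_shift N e))) l' ->
  l = Cmul zeta (Cadd (Cmul (Copp (e 1%nat)) c) l').
Proof.
  intros Hc Hl Hl'. apply (csums_unique _ _ _ Hl).
  replace (Cmul zeta _) with (Cadd (Cmul (Cpow zeta 0) (Cpairing N Q 0 e))
    (Cmul zeta (Cadd (Cmul (Copp (e 1%nat)) c) l')))
    by (unfold Cpairing; simpl; ring).
  apply (csums_shift (fun n => Cmul (Cpow zeta n) (Cpairing N Q n e))).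
  apply (csums_ext (fun n => Cmul zeta (Cadd
    (Cmul (Copp (e 1%nat)) (Cmul (Cpow zeta n) (RtoC (incr N Q n))))
    (Cmul (Cpow zeta n) (Cpairing N Q n (Clazy_shift N e)))))).
  - intros n. rewrite Cpairing_S. simpl. ring.
  - apply csums_scal, csums_plus; [now apply csums_scal|assumption].
Qed.

Definition Qentry (N : nat) (Q : nat -> nat -> R) (i j s : nat) : Cplx :=
  RtoC (Rmat_pow N Q s i j).

(** Shifting in [s] acts as left multiplication by [P], so the equations for the entries of [Q^s]
    form a closed linear system. *)
Lemma Qentry_shift (N : nat) (Q : nat -> nat -> R) (i j s : nat) :
  (i < N)%nat ->
  Clazy_shift N (Qentry N Q i j) s =
  csum N (fun k => Cmul (RtoC (lazy N Q i k)) (Qentry N Q k j s)).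
Proof.
  intros Hi. unfold Clazy_shift, Qentry.
  rewrite (csum_ext N _ (fun k => RtoC (lazy N Q i k * Rmat_pow N Q s k j)))
    by (intros; now rewrite RtoC_mul).
  rewrite csum_RtoC.
  change (rsum N _) with (Rmat_mul N (lazy N Q) (Rmat_pow N Q s) i j).
  rewrite lazy_mul by assumption. now rewrite RtoC_add, !RtoC_mul.
Qed.

Lemma incr_Cpairing (N : nat) (Q : nat -> nat -> R) (n : nat) :
  RtoC (incr N Q n) =
  Cmul (RtoC (2 / (INR N * INR N)))
    (Cadd Cone (csum N (fun i => Cpairing N Q n (Qentry N Q i i)))).
Proof.
  rewrite incr_pairing, RtoC_mul, RtoC_add. f_equal. f_equal.
  rewrite <- Cpairing_csum.
  transitivity (Cpairing N Q n (fun s => RtoC (Rtrace N (Rmat_pow N Q s)))).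
  - rewrite Cpairing_components. apply Cplx_ext; simpl; trivial.
    unfold pairing. rewrite (rsum_ext n _ (fun _ => 0)) by (intros; ring).
    now rewrite rsum_zero.
  - apply Cpairing_ext. intros s. unfold Qentry, Rtrace. now rewrite csum_RtoC.
Qed.

(* The series [Lambda] of the matrices [R_n(Q)] satisfies [(1 - zeta P) Lambda = - zeta c Q]; its trace feeds back into the definition of [incr]. *)
Lemma incr_series (N : nat) (Q : nat -> nat -> R) (zeta c : Cplx)
  (X : nat -> nat -> Cplx) :
  (4 <= N)%nat -> stochastic N Q -> symmetric N Q -> Cnorm zeta < 1 ->
  Cmat_inverse N (Mzeta N Q zeta) X ->
  csums (fun n => Cmul (Cpow zeta n) (RtoC (incr N Q n))) c ->
  Cmul (Csub Cone zeta) (Cmul (RtoC (INR N)) (Cmul c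
    (Cmul (Csub (RtoC (INR N)) (Cmul zeta (RtoC (INR N - 2)))) (Ctrace N X)))) =
  RtoC 2.
Proof.
  intros HN Hst Hsym Hz HX Hc.
  assert (HNR : INR N <> 0) by (apply not_0_INR; lia).
  set (g := Csum (fun n => Cmul (Cpow zeta n) Cone)).
  assert (Hg : csums (fun n => Cmul (Cpow zeta n) Cone) g).
  { apply csums_power_series; trivial. intros n. rewrite Cnorm_Cone.
    pose proof (pos_INR n). lra. }
  assert (Hg1 : g = Cadd Cone (Cmul zeta g)).
  { apply (csums_unique _ _ _ Hg).
    replace (Cadd Cone (Cmul zeta g)) with
      (Cadd (Cmul (Cpow zeta 0) Cone) (Cmul zeta g)) by (simpl; ring).
    apply (csums_shift (fun n => Cmul (Cpow zeta n) Cone)).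
    apply (csums_ext (fun n => Cmul zeta (Cmul (Cpow zeta n) Cone)));
      [intros; simpl; ring|now apply csums_scal]. }
  set (L := fun i j => Csum (fun n => Cmul (Cpow zeta n) (Cpairing N Q n (Qentry N Q i j)))).
  assert (HL : forall i j, (i < N)%nat ->
    csums (fun n => Cmul (Cpow zeta n) (Cpairing N Q n (Qentry N Q i j))) (L i j)).
  { intros i j Hi. apply csums_power_series; trivial. intros n.
    apply Rle_trans with (INR n); [|lra]. apply Cnorm_Cpairing; trivial.
    intros s. unfold Qentry. rewrite Cnorm_RtoC.
    pose proof (stochastic_pow_bounds N Q s i j Hst Hi).
    rewrite Rabs_pos_eq; lra. }
  assert (HLeq : forall i j, (i < N)%nat -> (j < N)%nat ->
    L i j = Cmul zeta (Cadd (Cmul (Copp (RtoC (Q i j))) c)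
      (csum N (fun k => Cmul (RtoC (lazy N Q i k)) (L k j))))).
  { intros i j Hi Hj.
    replace (RtoC (Q i j)) with (Qentry N Q i j 1)
      by (unfold Qentry; simpl; now rewrite Rmat_mul_delta_r).
    apply (pairing_series N Q); trivial; [now apply HL|].
    apply (csums_ext (fun n => csum N (fun k => Cmul (RtoC (lazy N Q i k))
      (Cmul (Cpow zeta n) (Cpairing N Q n (Qentry N Q k j)))))).
    - intros n.
      rewrite (Cpairing_ext N Q n _ _ (fun s => Qentry_shift N Q i j s Hi)).
      rewrite Cpairing_csum, <- csum_scal. apply csum_ext. intros k _.
      rewrite Cpairing_scal. ring.
    - apply (csums_csum N (fun k n => Cmul (RtoC (lazy N Q i k))
        (Cmul (Cpow zeta n) (Cpairing N Q n (Qentry N Q k j))))).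
      intros k Hk. apply csums_scal. now apply HL. }
  (* Multiplied by [N], the system reads [N (1 - zeta P) L = - N zeta c Q], which [X] solves. *)
  assert (HtrL : Ctrace N L = Cmul (Copp (Cmul (RtoC (INR N)) (Cmul zeta c)))
     (Ctrace N (Cmat_mul N X (fun i j => RtoC (Q i j))))).
  { unfold Ctrace. rewrite <- csum_scal. apply csum_ext. intros i Hi.
    rewrite (resolvent_solve N (Mzeta N Q zeta) X L (fun k j =>
      Cmul (Copp (Cmul (RtoC (INR N)) (Cmul zeta c))) (RtoC (Q k j))) i i); trivial.
    - unfold Cmat_mul. rewrite <- csum_scal. apply csum_ext. intros. ring.
    - intros k Hk. rewrite Mzeta_mul, (HLeq k i) by assumption. ring. }
  (* Summing the definition of [c_n] against [zeta^n]; the constant 1 yields the geometric series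
     [g]. *)
  assert (Hcg : c = Cmul (RtoC (2 / (INR N * INR N))) (Cadd g (Ctrace N L))).
  { apply (csums_unique _ _ _ Hc).
    apply (csums_ext (fun n => Cmul (RtoC (2 / (INR N * INR N)))
      (Cadd (Cmul (Cpow zeta n) Cone)
        (csum N (fun i => Cmul (Cpow zeta n) (Cpairing N Q n (Qentry N Q i i))))))).
    - intros n. rewrite incr_Cpairing, csum_scal. ring.
    - apply csums_scal, csums_plus; trivial.
      apply (csums_csum N (fun i n => Cmul (Cpow zeta n) (Cpairing N Q n (Qentry N Q i i)))).
      intros i Hi. now apply HL. }
  pose proof (Ctrace_resolvent N Q zeta X HX) as Hx.
  rewrite HtrL in Hcg. clear HtrL HLeq HL.
  set (x := Ctrace N X) in *.
  set (y := Ctrace N (Cmat_mul N X (fun i j => RtoC (Q i j)))) in *.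
  set (D := Csub (RtoC (INR N)) (Cmul zeta (RtoC (INR N - 2)))) in *.
  rewrite RtoC_div, RtoC_mul in Hcg by nra.
  assert (HN0 : RtoC (INR N) <> Czero) by now apply RtoC_neq_0.
  set (M := RtoC (INR N)) in *.
  assert (Hc2 : Cmul (Cmul M M) c =
     Cmul (RtoC 2) (Cadd g (Cmul (Copp (Cmul M (Cmul zeta c))) y))).
  { rewrite Hcg at 1. field. assumption. }
  assert (Hg2 : Cmul (Csub Cone zeta) g = Cone).
  { transitivity (Csub g (Cmul zeta g)); [ring|]. rewrite Hg1 at 1. ring. }
  (* Substituting [D x = N + 2 zeta y] cancels the unknown trace [y] of [X Q]. *)
  assert (H2g : Cmul M (Cmul c (Cmul D x)) = Cmul (RtoC 2) g).
  { assert (HDx : Cmul D x = Cadd M (Cmul (Cmul (RtoC 2) zeta) y))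
      by (rewrite <- Hx; ring).
    rewrite HDx.
    transitivity (Cadd (Cmul (Cmul M M) c) (Cmul M (Cmul c (Cmul (Cmul (RtoC 2) zeta) y))));
      [ring|]. rewrite Hc2. ring. }
  rewrite H2g.
  transitivity (Cmul (RtoC 2) (Cmul (Csub Cone zeta) g)); [ring|].
  rewrite Hg2. ring.
Qed.

(** Since [|N-2+2q| <= N], a zero would force [N <= |zeta| N]. *)
Lemma denominator_neq_0 (N : nat) (zeta q : Cplx) :
  (2 <= N)%nat -> Cnorm zeta < 1 -> Cnorm q <= 1 ->
  Csub (RtoC (INR N)) (Cmul zeta (Cadd (RtoC (INR N - 2)) (Cmul (RtoC 2) q))) <> Czero.
Proof.
  intros HN Hz Hq H.
  assert (H2 : 2 <= INR N) by (apply (le_INR 2); assumption).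
  set (w := Cadd (RtoC (INR N - 2)) (Cmul (RtoC 2) q)) in *.
  assert (E : RtoC (INR N) = Cmul zeta w).
  { transitivity (Cadd (Csub (RtoC (INR N)) (Cmul zeta w)) (Cmul zeta w)); [ring|].
    rewrite H. ring. }
  apply (f_equal Cnorm) in E. rewrite Cnorm_mul, Cnorm_RtoC, Rabs_pos_eq in E by lra.
  assert (Hw : Cnorm w <= INR N).
  { eapply Rle_trans; [apply Cnorm_triangle|].
    rewrite Cnorm_mul, !Cnorm_RtoC, !Rabs_pos_eq by lra. lra. }
  pose proof (Cnorm_nonneg zeta). pose proof (Cnorm_nonneg w). nra.
Qed.

Theorem theorem3p2 (N : nat) (Q : nat -> nat -> R)
  (hN : (N > 8)%nat)
  (hstoch : stochastic N Q) (hirr : irreducible N Q)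
  (hsym : symmetric N Q) (htr : Rtrace N Q = 0)
  (zeta q : Cplx) (hz : Cnorm zeta < 1) (hq : Cnorm q <= 1) :
  (* absolute convergence of the double series sum_{n,s} zeta^n q^s alpha(n,s) *)
  (exists B : R, forall K : nat, Gabs_partial N Q zeta q K <= B) /\
  (* the matrix N - zeta(N-2+2Q) is invertible *)
  (exists X : nat -> nat -> Cplx, Cmat_inverse N (Mzeta N Q zeta) X) /\
  (* for its inverse X, the denominators are nonzero and the formula holds *)
  (forall X : nat -> nat -> Cplx, Cmat_inverse N (Mzeta N Q zeta) X ->
     Csub (RtoC (INR N)) (Cmul zeta (Cadd (RtoC (INR N - 2)) (Cmul (RtoC 2) q))) <> Czero /\
     Ctrace N X <> Czero /\
     Ccv (Gpartial N Q zeta q)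
       (Cdiv
          (Cmul (Cmul (RtoC 2) zeta)
             (Cmul (Csub Cone q)
                (Cinv (Csub (RtoC (INR N))
                         (Cmul zeta (Cadd (RtoC (INR N - 2)) (Cmul (RtoC 2) q)))))))
          (Cmul (RtoC (INR N)) (Cmul (Cpow (Csub Cone zeta) 2) (Ctrace N X))))).
Proof.
  assert (H4 : (4 <= N)%nat) by lia.
  split; [eexists; intros K; now apply Gabs_partial_le|].
  split; [apply resolvent_exists; trivial; lia|].
  intros X HX.
  pose proof (denominator_neq_0 N zeta q ltac:(lia) hz hq) as HW.
  assert (HNR : INR N <> 0) by (apply not_0_INR; lia).
  assert (HN0 : RtoC (INR N) <> Czero) by now apply RtoC_neq_0.
  assert (H20 : RtoC 2 <> Czero) by (apply RtoC_neq_0; lra).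
  assert (Hz1 : Csub Cone zeta <> Czero).
  { intros H. replace zeta with Cone in hz.
    - rewrite Cnorm_Cone in hz. lra.
    - transitivity (Cadd (Csub Cone zeta) zeta); [ring|]. rewrite H. ring. }
  set (c := Csum (fun n => Cmul (Cpow zeta n) (RtoC (incr N Q n)))).
  assert (Hc : csums (fun n => Cmul (Cpow zeta n) (RtoC (incr N Q n))) c).
  { apply csums_power_series; trivial. intros n. rewrite Cnorm_RtoC.
    pose proof (incr_bounds N Q n H4 hstoch hsym). pose proof (pos_INR n).
    rewrite Rabs_pos_eq; lra. }
  pose proof (incr_series N Q zeta c X H4 hstoch hsym hz HX Hc) as HcX.
  set (D := Csub (RtoC (INR N)) (Cmul zeta (RtoC (INR N - 2)))) in *.
  (* A vanishing trace would make the identity [HcX] read [0 = 2]. *)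
  assert (Hx : Ctrace N X <> Czero).
  { intros H. apply H20. rewrite <- HcX, H. ring. }
  split; [assumption|]. split; [assumption|].
  set (a := Csum (fun n => Cmul (Cpow zeta n) (RtoC (alpha N Q n 0)))).
  assert (Ha : csums (fun n => Cmul (Cpow zeta n) (RtoC (alpha N Q n 0))) a).
  { apply csums_power_series; trivial. intros n. rewrite Cnorm_RtoC.
    pose proof (alpha_0_bounds N Q n H4 hstoch hsym). rewrite Rabs_pos_eq; lra. }
  assert (Haeq : a = Cmul zeta (Cadd a c)).
  { apply (csums_unique _ _ _ Ha).
    replace (Cmul zeta _) with (Cadd (Cmul (Cpow zeta 0) (RtoC (alpha N Q 0 0)))
      (Cmul zeta (Cadd a c))) by (rewrite alpha_0_s; change (RtoC 0) with Czero; ring).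
    apply (csums_shift (fun n => Cmul (Cpow zeta n) (RtoC (alpha N Q n 0)))).
    apply (csums_ext (fun n => Cmul zeta (Cadd
      (Cmul (Cpow zeta n) (RtoC (alpha N Q n 0)))
      (Cmul (Cpow zeta n) (RtoC (incr N Q n)))))).
    - intros n. rewrite alpha_S_0, RtoC_add. simpl. ring.
    - now apply csums_scal, csums_plus. }
  set (l := Csum (fun n => Cmul (Cpow zeta n) (Cpairing N Q n (Cpow q)))).
  assert (Hl : csums (fun n => Cmul (Cpow zeta n) (Cpairing N Q n (Cpow q))) l).
  { apply csums_power_series; trivial. intros n.
    apply Rle_trans with (INR n); [|lra]. apply Cnorm_Cpairing; trivial.
    intros s. rewrite Cnorm_pow, <- (pow1 s). apply pow_incr.
    split; [apply Cnorm_nonneg|assumption]. }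
  set (w := Cadd (RtoC (INR N - 2)) (Cmul (RtoC 2) q)) in *.
  (* On the sequence [q^s] the lazy shift is multiplication by [w / N], so the equation for [l] is
     scalar. *)
  assert (Hleq : l = Cmul zeta (Cadd (Cmul (Copp q) c) (Cmul (Cdiv w (RtoC (INR N))) l))).
  { replace q with (Cpow q 1) at 1 by (simpl; ring).
    apply (pairing_series N Q); trivial.
    apply (csums_ext (fun n => Cmul (Cdiv w (RtoC (INR N)))
      (Cmul (Cpow zeta n) (Cpairing N Q n (Cpow q))))); [|now apply csums_scal].
    intros n.
    rewrite (Cpairing_ext N Q n (Clazy_shift N (Cpow q))
      (fun s => Cmul (Cdiv w (RtoC (INR N))) (Cpow q s))).
    - rewrite Cpairing_scal. ring.
    - intros s. unfold Clazy_shift, w. rewrite !RtoC_div by assumption.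
      simpl Cpow. field. assumption. }
  assert (Htot : csums (fun n => Cmul (Cpow zeta n)
    (Cadd (RtoC (alpha N Q n 0)) (Cpairing N Q n (Cpow q)))) (Cadd a l)).
  { apply (csums_ext (fun n => Cadd (Cmul (Cpow zeta n) (RtoC (alpha N Q n 0)))
      (Cmul (Cpow zeta n) (Cpairing N Q n (Cpow q))))); [intros; ring|].
    now apply csums_plus. }
  assert (Hval : Cadd a l = Cdiv
    (Cmul (Cmul (RtoC 2) zeta) (Cmul (Csub Cone q)
       (Cinv (Csub (RtoC (INR N)) (Cmul zeta w)))))
    (Cmul (RtoC (INR N)) (Cmul (Cpow (Csub Cone zeta) 2) (Ctrace N X)))).
  { set (M := RtoC (INR N)) in *. set (x := Ctrace N X) in *.
    assert (Ea : a = Cdiv (Cmul zeta c) (Csub Cone zeta)).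
    { transitivity (Cdiv (Csub a (Cmul zeta a)) (Csub Cone zeta)); [field; assumption|].
      rewrite Haeq at 1. f_equal. ring. }
    assert (El : l = Cdiv (Copp (Cmul M (Cmul zeta (Cmul c q)))) (Csub M (Cmul zeta w))).
    { transitivity (Cdiv (Cmul M (Csub l (Cmul zeta (Cmul (Cdiv w M) l))))
        (Csub M (Cmul zeta w))); [field; split; assumption|].
      rewrite Hleq at 1. f_equal. ring. }
    assert (EcD : Cmul c D = Cdiv (RtoC 2) (Cmul (Csub Cone zeta) (Cmul M x))).
    { rewrite <- HcX. field. repeat split; assumption. }
    (* Over a common denominator the numerator is [zeta c (N - zeta w - N q (1 - zeta))], which
       factors as [zeta c (1 - q) D]. Thus [c] enters only through [c D], given by [EcD]. *)
    transitivity (Cdiv (Cmul zeta (Cmul (Csub Cone q) (Cmul c D)))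
      (Cmul (Csub Cone zeta) (Csub M (Cmul zeta w)))).
    (* Both [w] and [D] are expressed through [M] and [Cone], so that [field] sees the relation
       between them. *)
    - assert (Ew : w = Cadd (Csub M (Cadd Cone Cone)) (Cmul (Cadd Cone Cone) q))
        by (unfold w, M; now rewrite RtoC_sub, RtoC_2).
      assert (ED : D = Csub M (Cmul zeta (Csub M (Cadd Cone Cone))))
        by (unfold D, M; now rewrite RtoC_sub, RtoC_2).
      clearbody w D. rewrite Ea, El, ED, Ew. rewrite Ew in HW.
      field. split; assumption.
    - rewrite EcD. simpl Cpow. field. repeat split; assumption. }
  rewrite <- Hval. intros eps Heps.
  destruct (csums_Ccv _ _ Htot eps Heps) as [K0 HK0].
  exists K0. intros K HK. unfold Gpartial.
  rewrite (csum_ext K _ (fun n => Cmul (Cpow zeta n)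
    (Cadd (RtoC (alpha N Q n 0)) (Cpairing N Q n (Cpow q))))).
  - now apply HK0.
  - intros n Hn. now apply Gterm_sum.
Qed.
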